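(* Let $n$ be a positive integer and let $\mu$ be an $n$-completely mixable probability measure on $\mathbb{R}$. Then $\Lambda_n(\mu)$, with the topology of weak convergence, is a compact metric (i.e. compact metrizable) space and the function $\phi:\Lambda_n(\mu)\to\mathbb{R}$, which maps each $\lambda\in\Lambda_n(\mu)$ to its $n$-center, is continuous. In particular, the set $\phi(\Lambda_n(\mu))$ of $n$-centers of $\mu$ is compact. Thus, there exist real numbers $a\le b$ such that $a$ and $b$ are $n$-centers of $\mu$ but no point of $(-\infty,a)\cup(b,+\infty)$ is an $n$-center of $\mu$.
   Context: All probability measures are Borel. For a probability measure $\mu$ on $\mathbb{R}$, let $\Gamma(\mu,\dots,\mu)$ be the set of probability measures on $\mathbb{R}^n$ all of whose $n$ one-dimensional marginals equal $\mu$. Let $\Lambda_n(\mu)$ be the set of those $\lambda\in\Gamma(\mu,\dots,\mu)$ such that $\lambda(\{x\in\mathbb{R}^n: x_1+\dots+x_n=C\})=1$ for some $C\in\mathbb{R}$. For such $\lambda$, the (necessarily unique) number $C/n$ is called the $n$-center of $\lambda$ and is denoted $\phi(\lambda)$. The measure $\mu$ is called $n$-completely mixable if $\Lambda_n(\mu)\neq\emptyset$. The $n$-centers of $\mu$ are the numbers $\phi(\lambda)$, $\lambda\in\Lambda_n(\mu)$. The set $\Lambda_n(\mu)$ carries the topology of weak convergence of probability measures on $\mathbb{R}^n$. *)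

(* Defs.v *)
From HB Require Import structures.
From mathcomp Require Import all_boot all_order all_algebra.
From mathcomp Require Import all_classical all_reals all_analysis.
Set Implicit Arguments.
Unset Strict Implicit.
Unset Printing Implicit Defensive.
Import Order.TTheory GRing.Theory Num.Theory.
Import numFieldNormedType.Exports.
Local Open Scope classical_set_scope.
Local Open Scope ring_scope.

Notation borelRn R n := (g_sigma_algebraType (@open 'rV[R]_n)).

Definition metrizable (R : realType) (T : topologicalType) : Prop :=
  exists d : T -> T -> R,
    [/\ forall x y, 0 <= d x y,
        forall x y, d x y = 0 <-> x = y,
        forall x y, d x y = d y x,
        forall x y z, d x z <= d x y + d y z
      & forall x : T, nbhs x =
          filter_from [set e : R | 0 < e] (fun e => [set y | d x y < e])].

(* A [probability T R] assigns a value to every subset of T, but only its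
   values on measurable sets are constrained, so two terms that are the same
   measure need not be equal.  We keep the representative that vanishes outside
   the sigma-algebra: every Borel probability measure has exactly one
   (lemma [borel_prob_repr]), so equality in [borel_prob] is equality of
   measures. *)
Definition borel_prob (R : realType) (n : nat) : Type :=
  [set P : probability (borelRn R n) R | forall A, ~ measurable A -> P A = 0%E].

Definition measure_of (R : realType) (n : nat) (P : borel_prob R n) :
  probability (borelRn R n) R := val P.
Coercion measure_of : borel_prob >-> Probability.type.

Lemma eq_probability d (T : measurableType d) (R : realType)
    (P Q : probability T R) : P =1 Q -> P = Q.
Proof.
move: P Q => [p Hp] [q Hq] /= /funext pq; rewrite -{q}pq in Hq *.
congr Probability.Pack; case: Hp => a1 a2 a3 a4 a5 a6 a7.
case: Hq => b1 b2 b3 b4 b5 b6 b7.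
have e1 : a1 = b1.
  case: a1 b1 {a2 b2} => ? ? [? ?].
  by congr isContent.Axioms_; exact: Prop_irrelevance.
rewrite -{b1}e1 in b2 *.
have -> : a2 = b2.
  by case: a2 b2 => ? [?]; congr Content_isMeasure.Axioms_; exact: Prop_irrelevance.
have -> : a3 = b3.
  by case: a3 b3 => ? [?]; congr isSFinite.Axioms_; exact: Prop_irrelevance.
have -> : a4 = b4.
  by case: a4 b4 => ? [?]; congr isSigmaFinite.Axioms_; exact: Prop_irrelevance.
have -> : a5 = b5.
  by case: a5 b5 => ? [?]; congr isFinite.Axioms_; exact: Prop_irrelevance.
have -> : a6 = b6.
  by case: a6 b6 => ? [?]; congr isSubProbability.Axioms_; exact: Prop_irrelevance.
have -> : a7 = b7.
  by case: a7 b7 => ? [?]; congr isProbability.Axioms_; exact: Prop_irrelevance.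
by [].
Qed.

Section borel_prob_repr.
Variables (R : realType) (n : nat) (P : probability (borelRn R n) R).
Local Open Scope ereal_scope.

Let Q (A : set (borelRn R n)) : \bar R :=
  if pselect (measurable A) then P A else 0.

Let QE A : measurable A -> Q A = P A.
Proof. by rewrite /Q; case: pselect. Qed.

Let Q0 : Q set0 = 0.
Proof. by rewrite QE ?measure0. Qed.

Let Q_ge0 A : 0 <= Q A.
Proof. by rewrite /Q; case: (pselect _) => ?; rewrite ?measure_ge0. Qed.

Let Q_sigma_additive : semi_sigma_additive Q.
Proof.
move=> F mF tF mUF; rewrite QE//.
under eq_fun do under eq_bigr do rewrite QE//.
exact: measure_semi_sigma_additive.
Qed.

HB.instance Definition _ := isMeasure.Build _ _ _ Q Q0 Q_ge0 Q_sigma_additive.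

Let QT : Q setT = 1.
Proof. by rewrite QE ?probability_setT. Qed.

HB.instance Definition _ := Measure_isProbability.Build _ _ _ Q QT.

Lemma borel_prob_repr :
  exists! P' : borel_prob R n, forall A, measurable A -> P' A = P A.
Proof.
have Q_borel : forall A, ~ measurable A -> (Q : probability _ R) A = 0.
  by move=> A; rewrite /= /Q; case: pselect.
exists (exist _ (Q : probability _ R) (mem_set Q_borel)).
split=> [A mA|[P' P'_borel] P'E]; first exact: QE.
apply/eq_sig_hprop => /=; first by move=> ? ? ?; exact: bool_irrelevance.
apply: eq_probability => A; rewrite /= /Q; case: pselect => [mA|nmA].
  by rewrite -P'E.
by rewrite (set_mem P'_borel).
Qed.

End borel_prob_repr.

Definition bounded_continuous (R : realType) (n : nat) : Type :=
  [set f : 'rV[R]_n -> R | continuous f /\ bounded_fun f].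

Definition expectations (R : realType) (n : nat) (P : borel_prob R n) :
    prod_topology (fun _ : bounded_continuous R n => R) :=
  fun f => \int[P]_x (val f : 'rV[R]_n -> R) x.

(* Topology of weak convergence: the coarsest one making every
   [P |-> \int f dP], f bounded continuous, continuous (see [weak_cvgP]). *)
HB.instance Definition _ (R : realType) (n : nat) :=
  Choice.on (borel_prob R n).
HB.instance Definition _ (R : realType) (n : nat) :=
  Topological.copy (borel_prob R n) (initial_topology (@expectations R n)).

Lemma weak_cvgP (R : realType) (n : nat) (F : set_system (borel_prob R n))
    (P : borel_prob R n) : Filter F ->
  F --> P <->
  forall f : 'rV[R]_n -> R, continuous f -> bounded_fun f ->
    (fun Q : borel_prob R n => \int[Q]_x f x) @ F --> \int[P]_x f x.
Proof.
move=> FF.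
have cvg_initial (S : choiceType) (T : topologicalType) (g : S -> T)
    (G : set_system S) (s : S) : Filter G ->
    G --> (s : initial_topology g) <-> g @ G --> g s.
  move=> FG; split=> [Gs|gGs A [_ [[B oB <-] Bs BA]]].
    by move=> A /(@initial_continuous _ _ g s); exact: Gs.
  by apply: filterS BA _; apply: gGs; exact: open_nbhs_nbhs.
rewrite cvg_initial cvg_sup; split=> [cvgF f fc fb|cvgF [f fcb]].
  have := cvgF (exist _ f (mem_set (conj fc fb))).
  by rewrite cvg_initial.
by rewrite cvg_initial; case: (set_mem fcb) => fc fb; exact: cvgF.
Qed.

Definition has_marginals (R : realType) (n : nat)
    (mu : probability (measurableTypeR R) R) (P : borel_prob R n) : Prop :=
  forall (i : 'I_n) (A : set (measurableTypeR R)), measurable A ->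
    pushforward P (fun x : borelRn R n => x ord0 i : measurableTypeR R) A
    = mu A.

Definition sum_is (R : realType) (n : nat) (P : borel_prob R n) (C : R) : Prop :=
  P [set x : 'rV[R]_n | \sum_(i < n) x ord0 i = C] = 1%E.

Definition Lambda (R : realType) (n : nat)
    (mu : probability (measurableTypeR R) R) : set (borel_prob R n) :=
  [set P | has_marginals mu P /\ exists C, sum_is P C].
Arguments Lambda [R] n mu.

Definition completely_mixable (R : realType) (n : nat)
    (mu : probability (measurableTypeR R) R) : Prop :=
  Lambda n mu !=set0.
Arguments completely_mixable [R] n mu.

(* [get] picks the constant C, which is unique when it exists
   (lemma [ncenterE]). *)
Definition ncenter (R : realType) (n : nat) (P : borel_prob R n) : R :=
  get [set C | sum_is P C] / n%:R.

Lemma ncenterE (R : realType) (n : nat) (P : borel_prob R n) (C : R) :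
  sum_is P C -> ncenter P = C / n%:R.
Proof.
move=> PC; rewrite /ncenter; congr (_ / _); apply: get_unique => // C' PC'.
pose H (c : R) : set (borelRn R n) := [set x | \sum_(i < n) x ord0 i = c].
have sum_continuous (s : seq 'I_n) :
    continuous (fun x : 'rV[R]_n => \sum_(i <- s) x ord0 i).
  elim: s => [|i s IHs].
    rewrite [X in continuous X](_ : _ = cst 0); first exact: cst_continuous.
    by apply/funext => x; rewrite big_nil.
  rewrite [X in continuous X](_ : _ =
      (fun x : 'rV[R]_n => x ord0 i) \+ (fun x => \sum_(j <- s) x ord0 j)).
    by move=> x; apply: continuousD (IHs x); exact: coord_continuous.
  by apply/funext => x; rewrite big_cons.
have mH c : measurable (H c).
  rewrite -[H c]setCK; apply: measurableC; apply: sub_sigma_algebra.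
  rewrite /= openC; apply: (@preimage_closed _ _ _ [set c]) => [x _|].
    exact: sum_continuous.
  exact: closed_eq.
apply/eqP/negPn/negP => C'C.
have : (P (H C') + P (H C) <= 1)%E.
  rewrite -measureU//; last first.
    by rewrite -subset0 => x [/= xC' xC]; move: C'C; rewrite -xC' -xC eqxx.
  by apply: probability_le1; exact: measurableU.
by rewrite [P (H C')]PC' [P (H C)]PC -EFinD lee_fin gerDl ler10.
Qed.

(* [phi], with the set [Lambda n mu] coerced to a type, which carries the
   subspace topology. *)
Definition phi (R : realType) (n : nat)
    (mu : probability (measurableTypeR R) R) (P : Lambda n mu) : R :=
  ncenter (val P).
Arguments phi {R n mu} P.

Definition ncenters (R : realType) (n : nat)
    (mu : probability (measurableTypeR R) R) : set R :=
  range (@phi R n mu).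
Arguments ncenters [R] n mu.

(* Main.v *)
(* Compactness: along an ultrafilter on [Lambda n mu] the masses [P A] converge,
   for every Borel set [A], to a finitely additive [rho A].  The sets that can be
   squeezed between a compact and an open set with small [rho]-gap form an
   algebra.  It contains all boxes, because all marginals equal [mu], and on it
   [rho] is sigma-subadditive by compactness; so [rho] extends from it to a Borel
   measure [nu].  Step functions on boxes show that the ultrafilter converges
   weakly to [nu].

   Centers: tightness bounds the constant coordinate sums uniformly by some [B],
   so the sum of [P] is the integral of the coordinate sum truncated at [B], a
   bounded continuous function.  Hence the sums depend continuously on [P], and
   the limit [nu] is again concentrated on a hyperplane.

   Metrizability: the integrals of the powers of tent functions on rational boxes
   are countably many continuous functions separating the points of a compact
   space. *)

Require Import Defs.
From HB Require Import structures.
From mathcomp Require Import all_boot all_order all_algebra.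
From mathcomp Require Import finmap.
From mathcomp Require Import all_classical all_reals all_analysis.
From mathcomp Require Import measurable_realfun lra.
Import Order.TTheory GRing.Theory Num.Theory.
Import numFieldNormedType.Exports.
Local Open Scope classical_set_scope.
Local Open Scope ring_scope.

(** * Boxes and Borel sets of row vectors *)

Section boxes.
Context {R : realType} {n : nat}.
Implicit Types (a b x : 'rV[R]_n) (q : 'rV[rat]_n * 'rV[rat]_n).

Definition box a b : set 'rV[R]_n :=
  [set x | forall i, a ord0 i <= x ord0 i <= b ord0 i].

Definition cube (M : R) : set 'rV[R]_n := box (const_mx (- M)) (const_mx M).

Definition rat_box q : set 'rV[R]_n := box (map_mx ratr q.1) (map_mx ratr q.2).

Lemma cubeP M x : cube M x <-> forall i, `|x ord0 i| <= M.
Proof. by split=> xM i; move: (xM i); rewrite !mxE ler_norml. Qed.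

Lemma boxE a b :
  box a b =
  \bigcap_(i : 'I_n) ((fun x => x ord0 i) @^-1` `[a ord0 i, b ord0 i]).
Proof.
apply/seteqP; split=> [x xab i _|x xab i]; first by rewrite /= in_itv/= xab.
by have := xab i I; rewrite /= in_itv.
Qed.

Lemma compact_box a b : compact (box a b).
Proof.
have := @rV_compact _ n (fun i => `[a ord0 i, b ord0 i]%classic)
  (fun i => @segment_compact _ _ _).
congr (compact _); apply/seteqP; split=> x xab i; have := xab i;
  by rewrite /= in_itv.
Qed.

Lemma nbhs_box (c : 'rV[R]_n) (r : R) : 0 < r ->
  nbhs c (box (c - const_mx r) (c + const_mx r)).
Proof.
move=> r0; apply/nbhs_ballP; exists r => //= x [_ cx] i; have := cx ord0 i.
by rewrite !mxE -ball_normE/= distrC ltr_distl => /andP[/ltW -> /ltW ->].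
Qed.

(** Makes the rational boxes a pi-system, as uniqueness of measures requires. *)
Lemma rat_boxI q1 q2 : exists q, rat_box q = rat_box q1 `&` rat_box q2.
Proof.
exists (\row_i Num.max (q1.1 ord0 i) (q2.1 ord0 i),
        \row_i Num.min (q1.2 ord0 i) (q2.2 ord0 i)).
have maxE (s t : rat) : ratr (Num.max s t) = Num.max (ratr s) (ratr t) :> R.
  by rewrite maxEle (maxEle (ratr _)) ler_rat; case: ifP.
have minE (s t : rat) : ratr (Num.min s t) = Num.min (ratr s) (ratr t) :> R.
  by rewrite minEle (minEle (ratr _)) ler_rat; case: ifP.
apply/seteqP; split=> [x xq|x [xq1 xq2] i].
  by split=> i; have := xq i; rewrite !mxE/= maxE minE ge_max le_min =>
    /andP[/andP[? ?] /andP[? ?]]; apply/andP.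
have := xq1 i; have := xq2 i; rewrite !mxE/= maxE minE ge_max le_min.
by move=> /andP[-> ->] /andP[-> ->].
Qed.

(** Around each point of [U], rational corners taken within the radius of a ball in [U] give a box
    that stays in [U]. *)
Lemma open_bigcup_rat_box (U : set 'rV[R]_n) : open U ->
  U = \bigcup_(q in [set q | rat_box q `<=` U]) rat_box q.
Proof.
move=> oU; apply/seteqP; split=> [x Ux|x [q qU]]; last exact: qU.
have /nbhs_ballP[e /= e0 xeU] : nbhs x U by apply: open_nbhs_nbhs.
have lo i : {q : rat | x ord0 i - e < ratr q < x ord0 i}.
  by apply/cid; have [|q] := @rat_in_itvoo R (x ord0 i - e) (x ord0 i);
    [rewrite ltrBlDr ltrDl|rewrite in_itv; exists q].
have hi i : {q : rat | x ord0 i < ratr q < x ord0 i + e}.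
  by apply/cid; have [|q] := @rat_in_itvoo R (x ord0 i) (x ord0 i + e);
    [rewrite ltrDl|rewrite in_itv; exists q].
exists (\row_i sval (lo i), \row_i sval (hi i)).
  move=> y yq; apply: xeU; split=> // i j; rewrite ord1 -ball_normE/=.
  have := yq j; rewrite !mxE/= => /andP[ly yh].
  have /andP[le_ _] := svalP (lo j); have /andP[_ he] := svalP (hi j).
  by rewrite distrC ltr_distl (lt_le_trans le_)//= (le_lt_trans yh).
move=> i; rewrite !mxE/=.
by have /andP[_ /ltW ->] := svalP (lo i); have /andP[/ltW -> _] := svalP (hi i).
Qed.

End boxes.

Section borel_row_vectors.
Context {R : realType} {n : nat}.
Local Notation borel := (borelRn R n).

Lemma open_borel (U : set 'rV[R]_n) : open U -> measurable (U : set borel).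
Proof. by move=> oU; exact: sub_sigma_algebra. Qed.

Lemma closed_borel (C : set 'rV[R]_n) : closed C -> measurable (C : set borel).
Proof.
by move=> /closed_openC/open_borel/measurableC; rewrite setCK.
Qed.

Lemma compact_borel (K : set 'rV[R]_n) :
  compact K -> measurable (K : set borel).
Proof.
move=> cK; apply: closed_borel.
exact: (compact_closed (@norm_hausdorff _ 'rV[R]_n)).
Qed.

Lemma continuous_borel (f : 'rV[R]_n -> R) : continuous f ->
  measurable_fun setT (f : borel -> measurableTypeR R).
Proof.
move=> /continuousP cf; apply: (measurability _
  (RGenOpens.measurableE R)).
move=> _ [_ [a [b ->] <-]]; rewrite setTI.
by apply: open_borel; apply: cf; apply: (@interval_open R).
Qed.

Lemma measurable_coord (i : 'I_n) :
  measurable_fun setT ((fun x => x ord0 i) : borel -> measurableTypeR R).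
Proof. apply: continuous_borel; exact: coord_continuous. Qed.

Lemma box_borel (a b : 'rV[R]_n) : measurable (box a b : set borel).
Proof. apply: compact_borel; exact: compact_box. Qed.

Lemma rat_box_generate (G : set (set borel)) (A : set borel) :
  (forall q, <<s G >> (rat_box q)) -> measurable A -> <<s G >> A.
Proof.
move=> Gbox; apply: smallest_sub; first exact: smallest_sigma_algebra.
move=> U /open_bigcup_rat_box ->.
pose T : measurableType _ := g_sigma_algebraType G.
(* Boxes not contained in [U] are replaced by the empty set, so that the union ranges over a whole
   countable type. *)
rewrite bigcup_mkcond.
apply: (@countable_bigcupT_measurable _ T _
  (fun q : 'rV[rat]_n * 'rV[rat]_n => _)) => [|q].
  exact: countableP.
by case: ifP => _; [exact: Gbox|exact: (@measurable0 _ T)].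
Qed.

End borel_row_vectors.

(** * Extending a content from an algebra of sets *)

Lemma pushforward_measureE (R : realType) d d' (T : measurableType d)
    (U : measurableType d') (m : {measure set T -> \bar R}) (f : T -> U) :
  measurable_fun setT f ->
  exists p : {measure set U -> \bar R}, forall A, p A = pushforward m f A.
Proof. by move=> mf; exists (pushforward m f). Unshelve. exact: mf. Qed.

Section content_extension.
Context {R : realType} {d} {T : measurableType d} (G : set (set T)).

(* The closure properties are arguments of this alias of [T] so that they can be
   recovered by structure inference. *)
Definition algebra_of of G set0 & setU_closed G & setC_closed G : Type := T.

Variables (G0 : G set0) (GU : setU_closed G) (GC : setC_closed G).
Local Notation algT := (algebra_of G0 GU GC).

HB.instance Definition _ := Pointed.on algT.
HB.instance Definition _ :=
  isAlgebraOfSets.Build default_measure_display algT G0 GU GC.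

(** An alias that remembers the subadditivity proof, so that structure inference can promote the
    content to a measure. *)
Definition algebra_content {m : {content set algT -> \bar R}}
  of measurable_subset_sigma_subadditive m := m : set algT -> \bar R.

Variables (m : {content set algT -> \bar R})
  (m_sub : measurable_subset_sigma_subadditive m).
Local Notation mm := (algebra_content m_sub).

HB.instance Definition _ := Content.on mm.
HB.instance Definition _ :=
  Content_SigmaSubAdditive_isMeasure.Build _ _ _ mm m_sub.

(** Carathéodory extension gives a measure on the sigma-algebra generated by the algebra. This
    contains the measurable sets of [T], so the pushforward along the identity lives on [T]. *)
Lemma content_extension : measurable `<=` <<s G >> ->
  exists nu : {measure set T -> \bar R}, forall A, G A -> nu A = m A.
Proof.
move=> mG; pose mu : {measure set algT -> \bar R} := mm.
have mid : measurable_fun setT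
    (idfun : g_sigma_algebraType (@measurable _ algT) -> T).
  by move=> _ A mA; rewrite setTI; exact: mG.
have [p pE] := pushforward_measureE _ _ _ _ _ (measure_extension mu) _ mid.
by exists p => A GA; rewrite pE; exact: (measurable_mu_extE mu).
Qed.

End content_extension.

Section measure_mass1.
Context {R : realType} {d} {T : measurableType d}.
Variables (m : {measure set T -> \bar R}) (mT : m setT = 1%E).

Definition measure_of_mass1 of m setT = 1%E : set T -> \bar R := m.
Local Notation mm := (measure_of_mass1 mT).

HB.instance Definition _ := Measure.on mm.
HB.instance Definition _ := Measure_isProbability.Build _ _ _ mm mT.

Lemma mass1_probability : exists p : probability T R, forall A, p A = m A.
Proof. by exists mm. Qed.

End measure_mass1.

(** * Tightness *)

Lemma probability_nonincreasing_lt d (T : measurableType d) (R : realType)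
    (P : probability T R) (F : (set T)^nat) (e : R) :
  (forall k, measurable (F k)) -> nonincreasing_seq F -> \bigcap_k F k = set0 ->
  0 < e -> exists k, (P (F k) < e%:E)%E.
Proof.
move=> mF niF capF e0.
have : P \o F @ \oo --> P (\bigcap_k F k).
  apply: nonincreasing_cvg_mu => //; last by rewrite capF.
  by rewrite (le_lt_trans (probability_le1 _ _)) ?ltry.
rewrite capF measure0 => /fine_cvgP[_ /cvgrPdist_lt/(_ _ e0)[k _ /(_ k)]].
move=> /(_ (leqnn k)); rewrite /= sub0r normrN => Pe; exists k.
rewrite -(fineK (fin_num_measure P _ (mF k))) lte_fin.
exact: le_lt_trans (ler_norm _) Pe.
Qed.

Lemma measure_bigsetU_le d (T : measurableType d)
    (R : realType) (m : {measure set T -> \bar R})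
    (I : Type) (s : seq I) (F : I -> set T) : (forall i, measurable (F i)) ->
  (m (\big[setU/set0]_(i <- s) F i) <= \sum_(i <- s) m (F i))%E.
Proof.
move=> mF; elim: s => [|i s IHs]; first by rewrite !big_nil measure0.
rewrite !big_cons; apply: le_trans (leeD2l _ IHs).
by apply: measureU2 => //; exact: bigsetU_measurable.
Qed.

Section tightness.
Context {R : realType} {n : nat} (mu : probability (measurableTypeR R) R).
Implicit Types P : borel_prob R n.

(** The margins of width [k.+1%:R^-1] decrease to the empty set, so continuity from above
    applies. *)
Lemma itv_outer_margin (a b e : R) : 0 < e ->
  exists2 d : R, 0 < d &
    (mu (`](a - d)%R, (b + d)%R[%classic `\` `[a, b]%classic) < e%:E)%E.
Proof.
move=> e0.
pose F (k : nat) : set (measurableTypeR R) :=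
  `]a - k.+1%:R^-1, b + k.+1%:R^-1[%classic `\` `[a, b]%classic.
have [| | |k Fk] := @probability_nonincreasing_lt _ _ _ mu F e _ _ _ e0.
- by move=> k; apply: measurableD; exact: measurable_itv.
- move=> k l kl; apply/subsetPset => x []/=.
  rewrite !in_itv/= => /andP[ax xb] nx.
  have lk : l.+1%:R^-1 <= k.+1%:R^-1 :> R by rewrite lef_pV2 ?posrE// ler_nat.
  split=> //=; rewrite in_itv/= (le_lt_trans _ ax) ?(lt_le_trans xb)//.
    by rewrite lerD2l.
  by rewrite lerD2l lerN2.
- rewrite -subset0 => x Fx; have [_] := Fx 0%N I; apply => /=.
  rewrite in_itv/= !leNgt; apply/andP; split; apply/negP => /ltr_add_invr[k xk];
    have [/= + _] := Fx k I; rewrite in_itv/= => /andP[].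
  + by rewrite ltrBlDr ltNge ltW.
  + by move=> _; rewrite ltNge ltW.
- by exists k.+1%:R^-1 => //; rewrite invr_gt0.
Qed.

(** Outside the cube some coordinate exceeds [M] in absolute value. The union bound reduces this to
    the tails of [mu], whence one [M] serves for all [P]. *)
Lemma cube_tight (e : R) : 0 < e -> exists2 M : R, 0 <= M &
  forall P, has_marginals mu P -> (P (~` cube M) < e%:E)%E.
Proof.
move=> e0.
pose F (k : nat) : set (measurableTypeR R) := ~` `[- k%:R, k%:R]%classic.
(* With [n.+1] the sum of the [n] tail bounds is strictly below [e], and [n = 0] is covered. *)
have e1 : 0 < e / n.+1%:R by rewrite divr_gt0.
have [| | |k Fk] := @probability_nonincreasing_lt _ _ _ mu F _ _ _ _ e1.
- by move=> k; apply: measurableC; exact: measurable_itv.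
- move=> k l kl; apply/subsetPset; apply: subsetC => x /=.
  rewrite !in_itv/= => /andP[kx xk].
  have kl' : k%:R <= l%:R :> R by rewrite ler_nat.
  by rewrite (le_trans _ kx) ?(le_trans xk)// lerN2.
- rewrite -subset0 => x Fx; apply: (Fx (Num.truncn `|x|).+1 I) => /=.
  by rewrite in_itv/= -ler_norml ltW// Num.Theory.truncnS_gt.
- exists k%:R => // P Pmu.
  have -> : ~` cube k%:R =
      \big[setU/set0]_(i : 'I_n) ((fun x : 'rV[R]_n => x ord0 i) @^-1` F k).
    rewrite -bigcup_seq.
    apply/seteqP; split=> [x /existsNP[i xi]|x [i _ xi] xk].
      exists i; rewrite /= ?mem_index_enum// /F/= in_itv/= => xk.
      by apply: xi; rewrite !mxE.
    by apply: xi; have := xk i; rewrite !mxE /preimage/= in_itv.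
  apply: (@le_lt_trans _ _ (\sum_(i : 'I_n) mu (F k))%E).
    have mF : measurable (F k) by apply: measurableC; exact: measurable_itv.
    apply: (le_trans (@measure_bigsetU_le _ (borelRn R n) R P _ _ _ _)) => [i|].
      by rewrite -[X in measurable X]setTI; exact: measurable_coord.
    by apply: lee_sum => i _; rewrite -(Pmu i _ mF).
  apply: (@le_lt_trans _ _ (\sum_(i : 'I_n) (e / n.+1%:R)%:E)%E).
    by apply: lee_sum => i _; exact: ltW.
  rewrite sumEFin lte_fin sumr_const card_ord -[X in X < _]mulr_natr -mulrA.
  rewrite gtr_pMr//.
  by rewrite mulrC ltr_pdivrMr ?ltr0n// mul1r ltr_nat.
Qed.

End tightness.

(** * Limits along an ultrafilter *)

(** The image filter has a cluster point [c] in the compact segment. For a neighbourhood [A] of [c],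
    the ultrafilter contains the preimage of [A] or of its complement, and the latter contradicts
    clustering. *)
Lemma ultra_bounded_cvg (R : realType) (I : Type) (F : set_system I)
    (FU : UltraFilter F) (g : I -> R) (a b : R) :
  (forall i, a <= g i <= b) -> cvg (g @ F).
Proof.
move=> gab; have : compact `[a, b]%classic by exact: segment_compact.
have gF : (g @ F) `[a, b]%classic.
  by apply: (@filterE _ F) => i; rewrite /preimage/= in_itv; exact: gab.
move=> /(_ (g @ F) _ gF)[c [_ clc]]; apply/cvg_ex; exists c => A Ac.
have [//|FnA] := in_ultra_setVsetC (g @^-1` A) FU.
by have [x []] := clc (~` A) A FnA Ac.
Qed.

Section ultralimit.
Context {R : realType} {n : nat} (mu : probability (measurableTypeR R) R).
Context {I : Type} (F : set_system I) {FU : UltraFilter F}.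
Variables (P : I -> borel_prob R n) (P_mu : forall i, has_marginals mu (P i)).
Local Notation borel := (borelRn R n).

Definition ultralim (A : set borel) : R := lim (fine (P i A) @[i --> F]).

Definition ultracontent (A : set borel) : \bar R := (ultralim A)%:E.

Let P01 i (A : set borel) : 0 <= fine (P i A) <= 1.
Proof.
have [mA|nmA] := pselect (measurable A); last first.
  (* The chosen representative vanishes outside the sigma-algebra, so the bounds hold for every
     set. *)
  by rewrite /measure_of (set_mem (valP (P i)))//= lexx ler01.
rewrite fine_ge0//= -lee_fin fineK ?probability_le1//.
exact: fin_num_measure.
Qed.

Lemma ultralim_cvg A : fine (P i A) @[i --> F] --> ultralim A.
Proof. exact: (@ultra_bounded_cvg R I F FU _ 0 1 (P01^~ A)). Qed.

Let ultralim_ge0 A : (0 <= ultracontent A)%E.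
Proof.
rewrite lee_fin; apply: limr_ge; first exact: (ultralim_cvg A).
by apply: nearW => i; have /andP[] := P01 i A.
Qed.

Let ultralim_additive : measure_function.semi_additive ultracontent.
Proof.
move=> A k mA tA mUA; rewrite sumEFin; congr EFin; apply/cvg_lim => //.
rewrite (_ : (fun _ => _) = (fun i => \sum_(j < k) fine (P i (A j)))).
  by apply: cvg_big => [|j _]; [exact: add_continuous|exact: ultralim_cvg].
apply/funext => i; rewrite measure_semi_additive// sum_fine// => j _.
exact: fin_num_measure.
Qed.

HB.instance Definition _ := isContent.Build _ borel R
  ultracontent ultralim_ge0 ultralim_additive.

Local Notation rho := ultracontent.

Let rho_lt_add (A B C : set borel) (e1 e2 : R) : measurable A ->
    measurable B -> measurable C -> C `<=` A `|` B ->
  (rho A < e1%:E -> rho B < e2%:E -> rho C < (e1 + e2)%:E)%E.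
Proof.
move=> mA mB mC CAB Ae Be; rewrite EFinD.
apply: (@le_lt_trans _ _ (rho A + rho B)%E); last exact: lteD.
apply: (@le_trans _ _ (rho (A `|` B))).
  by apply: le_measure => //; rewrite inE//; exact: measurableU.
exact: measureU2.
Qed.

Lemma ultracontent_cube (e : R) : 0 < e ->
  exists2 M, 0 <= M & (rho (~` cube M) < e%:E)%E.
Proof.
(* Passing to the limit weakens strict inequalities; [e / 2] leaves the room needed. *)
move=> e0; have e20 : 0 < e / 2 by rewrite divr_gt0.
have [M M0 Me] := @cube_tight _ n mu _ e20.
exists M => //; rewrite lte_fin; apply: (@le_lt_trans _ _ (e / 2)).
  apply: limr_le; first exact: ultralim_cvg.
  apply: nearW => i; rewrite -lee_fin fineK.
    by rewrite ltW// Me.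
  by apply: fin_num_measure; apply: measurableC; exact: box_borel.
by rewrite ltr_pdivrMr// ltr_pMr// ltr1n.
Qed.

Lemma ultracontent_coord (i : 'I_n) (A : set (measurableTypeR R)) :
  measurable A -> rho ((fun x => x ord0 i) @^-1` A) = mu A.
Proof.
move=> mA; rewrite -[RHS]fineK; last exact: fin_num_measure.
congr EFin; apply/cvg_lim => //.
rewrite (_ : (fun _ => _) = cst (fine (mu A))); first exact: cvg_cst.
by apply/funext => j; rewrite -(P_mu j i _ mA).
Qed.

(* A substitute for the continuity sets of the limit measure, which is still to
   be constructed. *)
Definition ultraregular (A : set borel) : Prop := measurable A /\
  forall e : R, 0 < e -> exists K V : set 'rV[R]_n,
    [/\ compact K, open V, K `<=` A, A `<=` V & (rho (V `\` K) < e%:E)%E].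

Let measurable_gap (K V : set 'rV[R]_n) : compact K -> open V ->
  measurable (V `\` K : set borel).
Proof.
by move=> cK oV; apply: measurableD; [exact: open_borel|exact: compact_borel].
Qed.

Lemma ultraregular0 : ultraregular set0.
Proof.
split=> // e e0; exists set0, set0; split=> //; first exact: compact0.
by rewrite setD0 measure0 lte_fin.
Qed.

(** Complementation swaps the roles of [K] and [V], but the complement of [V] is only closed.
    Cutting it by a cube makes it compact, at the cost of the small mass outside the cube. *)
Lemma ultraregularC : setC_closed ultraregular.
Proof.
move=> A [mA rA]; split=> [|e e0]; first exact: measurableC.
have e20 : 0 < e / 2 by rewrite divr_gt0.
have [K [V [cK oV KA AV VKe]]] := rA _ e20.
have [M M0 Me] := ultracontent_cube _ e20.
have cK' : compact (cube M `&` ~` V).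
  by apply: compact_closedI; [exact: compact_box|exact: open_closedC].
have oV' : open (~` K).
  by apply: closed_openC; exact: (compact_closed (@norm_hausdorff _ 'rV[R]_n)).
exists (cube M `&` ~` V), (~` K); split=> //.
- by move=> x [_ Vx] /AV.
- by move=> x Ax /KA.
- rewrite [e]splitr; apply: (rho_lt_add _ _ _ _ _ _ _ _ _ VKe Me).
  + exact: measurable_gap.
  + by apply: measurableC; exact: box_borel.
  + exact: measurable_gap.
  + move=> x [Kx /not_andP[Mx|/contrapT Vx]]; [by right|by left].
Qed.

Lemma ultraregularU : setU_closed ultraregular.
Proof.
move=> A B [mA rA] [mB rB]; split=> [|e e0]; first exact: measurableU.
have e20 : 0 < e / 2 by rewrite divr_gt0.
have [K [V [cK oV KA AV VKe]]] := rA _ e20.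
have [L [W [cL oW LB BW WLe]]] := rB _ e20.
exists (K `|` L), (V `|` W); split.
- exact: compactU.
- exact: openU.
- exact: setUSS.
- exact: setUSS.
- rewrite [e]splitr; apply: (rho_lt_add _ _ _ _ _ _ _ _ _ VKe WLe).
  + exact: measurable_gap.
  + exact: measurable_gap.
  + by apply: measurable_gap; [exact: compactU|exact: openU].
  + by move=> x [[Vx|Wx] /not_orP[Kx Lx]]; [left|right].
Qed.

Lemma ultraregularI : setI_closed ultraregular.
Proof.
move=> A B rA rB; rewrite -[A `&` B]setCK setCI.
by apply: ultraregularC; apply: ultraregularU; exact: ultraregularC.
Qed.

Lemma ultraregularT : ultraregular setT.
Proof. by rewrite -setC0; apply: ultraregularC; exact: ultraregular0. Qed.

(** The inner set is the slab cut by a cube, the outer one a slightly wider open slab. The inner gap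
    is controlled by tightness and the outer one by [mu], since [rho] of a coordinate preimage is a
    [mu]-mass. *)
Lemma ultraregular_coord (i : 'I_n) (a b : R) :
  ultraregular ((fun x => x ord0 i) @^-1` `[a, b]%classic).
Proof.
have mI : measurable (`[a, b]%classic : set (measurableTypeR R)).
  exact: measurable_itv.
split=> [|e e0].
  by rewrite -[X in measurable X]setTI; exact: measurable_coord.
have e20 : 0 < e / 2 by rewrite divr_gt0.
have [M M0 Me] := ultracontent_cube _ e20.
have [d d0 de] := itv_outer_margin mu a b _ e20.
pose K : set 'rV[R]_n := cube M `&` (fun x => x ord0 i) @^-1` `[a, b]%classic.
pose V : set 'rV[R]_n := (fun x => x ord0 i) @^-1` `]a - d, b + d[%classic.
have cK : compact K.
  apply: compact_closedI; first exact: compact_box.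
  apply: preimage_closed => [x _|]; first exact: coord_continuous.
  exact: (@interval_closed R).
have oV : open V.
  have /continuousP := @coord_continuous R 1 n ord0 i; apply.
  by apply: (@interval_open R).
exists K, V; split=> //.
- by move=> x [].
- move=> x; rewrite /V /preimage/= !in_itv/= => /andP[ax xb].
  by rewrite (lt_le_trans _ ax) ?(le_lt_trans xb)// ?ltrDl// ltrBlDr ltrDl.
- have mD : measurable
      (`]a - d, b + d[%classic `\` `[a, b]%classic : set (measurableTypeR R)).
    by apply: measurableD; exact: measurable_itv.
  have := ultracontent_coord i _ mD; move: de => /[swap] <- de.
  rewrite [e]splitr; apply: (rho_lt_add _ _ _ _ _ _ _ _ _ de Me).
  + by rewrite -[X in measurable X]setTI; exact: measurable_coord.
  + by apply: measurableC; exact: box_borel.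
  + exact: measurable_gap.
  + by move=> x [Vx /not_andP[Mx|Ix]]; [right|left].
Qed.

Lemma ultraregular_box (a b : 'rV[R]_n) : ultraregular (box a b).
Proof.
have -> : box a b = \big[setI/setT]_(i : 'I_n)
    ((fun x : 'rV[R]_n => x ord0 i) @^-1` `[a ord0 i, b ord0 i]%classic).
  rewrite boxE -bigcap_seq; apply/seteqP; split=> x xab i _; apply: xab => //.
  by rewrite /= mem_index_enum.
apply: (big_ind ultraregular) => [|A B|i _].
- exact: ultraregularT.
- exact: ultraregularI.
- exact: ultraregular_coord.
Qed.

(** [A] is nearly exhausted by a compact [K], and each [B k] nearly fills an open [W k]. Finitely
    many of the [W k] cover [K], so finite subadditivity of [rho] suffices. *)
Lemma ultracontent_sigma_subadditive (A : set borel) (B : (set borel)^nat) :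
  ultraregular A -> (forall k, ultraregular (B k)) ->
  subset_sigma_subadditive rho A B.
Proof.
move=> [mA rA] rB AB; apply/lee_addgt0Pr => e e0.
have e20 : 0 < e / 2 by rewrite divr_gt0.
have [K [V [cK oV KA AV VKe]]] := rA _ e20.
(* Half of [e] is spent on [A]; the other half is shared out geometrically among the [B k]. *)
have /choice[W WP] (k : nat) : exists W : set 'rV[R]_n, [/\ open W, B k `<=` W
    & (rho W <= rho (B k) + ((e / 2) / (2 ^ k.+1)%:R)%:E)%E].
  have ek : 0 < (e / 2) / (2 ^ k.+1)%:R by rewrite divr_gt0// ltr0n expn_gt0.
  have [L [W [cL oW LB BW WLe]]] := (rB k).2 _ ek.
  exists W; split=> //.
  have -> : W = (B k : set 'rV[R]_n) `|` (W `\` (L : set 'rV[R]_n)).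
    apply/seteqP; split=> [x Wx|x [/BW|[]]//].
    by have [/LB|] := pselect (L x); [left|right].
  apply: le_trans (measureU2 _ _ _) _.
  + by have [] := rB k.
  + exact: measurable_gap.
  + by rewrite leeD2l// ltW.
have KW : K `<=` \bigcup_k W k.
  by move=> x /KA/AB[k _ Bx]; exists k => //; have [_ + _] := WP k; apply.
have := cK; rewrite compact_cover => /(_ nat setT W)[k _||D _ KD].
- by have [] := WP k.
- exact: KW.
rewrite [e]splitr EFinD addeA.
apply: (@le_trans _ _ (rho K + (e / 2)%:E)%E).
  apply: (@le_trans _ _ (rho (K `|` (V `\` K)))).
    apply: le_measure; rewrite ?inE//.
      by apply: measurableU; [exact: compact_borel|exact: measurable_gap].
    by move=> x /AV Vx; have [|] := pselect (K x); [left|right].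
  apply: le_trans (measureU2 _ _ _) _.
  + exact: compact_borel.
  + exact: measurable_gap.
  + by rewrite leeD2l// ltW.
rewrite leeD2r//.
have KW' : (rho K <= \sum_(k \in [set` D]) rho (W k))%E.
  apply: (@content_sub_fsum _ _ borel rho nat _ K W) => //.
  - by move=> k _; have [oW _ _] := WP k; exact: open_borel.
  - exact: compact_borel.
apply: (le_trans KW').
(* The geometric errors add up to at most [e / 2]. It remains to bound the finite sum over [D] by
   the whole series of nonnegative terms. *)
have h := @epsilon_trick _ (fun k => rho (B k)) (e / 2) xpredT.
apply: le_trans (h _ (ltW e20)); last by [].
rewrite nneseries_esum; last first.
  by move=> k _; rewrite adde_ge0// lee_fin divr_ge0// ltW.
rewrite esum_ge//; exists [set` D] => //.
by apply: lee_fsum => // k _; have [] := WP k.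
Qed.

Local Notation algT := (algebra_of _ ultraregular0 ultraregularU ultraregularC).

Definition regular_content (A : set algT) : \bar R := rho A.

Let regular_content_ge0 A : (0 <= regular_content A)%E.
Proof. exact: measure_ge0. Qed.

Let regular_content_additive :
  measure_function.semi_additive regular_content.
Proof.
by move=> A k rA tA [mUA _]; apply: measure_semi_additive => // i; case: (rA i).
Qed.

HB.instance Definition _ := isContent.Build _ algT R
  regular_content regular_content_ge0 regular_content_additive.

Let regular_content_sub : measurable_subset_sigma_subadditive regular_content.
Proof. by move=> A B rB rA; exact: ultracontent_sigma_subadditive. Qed.

(** The regular sets form an algebra containing all boxes, so the extension of [rho] from it is a
    Borel measure. Convergence is claimed only on regular sets, where [nu] agrees with [rho]. *)
Lemma ultralimit_measure : exists nu : borel_prob R n,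
  forall A, ultraregular A -> fine (P i A) @[i --> F] --> fine (nu A).
Proof.
have [A mA|m mE] :=
    @content_extension R _ borel _ _ _ _ _ regular_content_sub.
  apply: rat_box_generate mA => q; apply: sub_sigma_algebra.
  exact: ultraregular_box.
have mT : m setT = 1%E.
  rewrite mE; last exact: ultraregularT.
  congr EFin; apply/cvg_lim => //.
  rewrite (_ : (fun _ => _) = cst 1); first exact: cvg_cst.
  by apply/funext => i; rewrite probability_setT.
have [p pE] := mass1_probability m mT.
have [nu [nuE _]] := borel_prob_repr p.
exists nu => A rA; rewrite nuE; last by have [] := rA.
by rewrite pE mE//; exact: ultralim_cvg.
Qed.

End ultralimit.

(** * Weak convergence *)

Section bounded_measurable.
Context {R : realType} {d} {T : measurableType d}.
Implicit Types (f g : T -> R) (P : probability T R) (A : set T).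

Definition bounded_measurable f : Prop :=
  measurable_fun setT f /\ exists L : R, forall x, `|f x| <= L.

Lemma bounded_measurable_integrable P f : bounded_measurable f ->
  P.-integrable setT (EFin \o f).
Proof.
move=> [mf [L fL]]; apply: measurable_bounded_integrable => //.
  by rewrite (le_lt_trans (probability_le1 _ _)) ?ltry.
exists L; split; first exact: num_real.
by move=> M LM x _; rewrite /= (le_trans (fL x))// ltW.
Qed.

Lemma bounded_measurableD f g : bounded_measurable f -> bounded_measurable g ->
  bounded_measurable (fun x => f x + g x).
Proof.
move=> [mf [L fL]] [mg [M gM]]; split; first exact: measurable_funD.
by exists (L + M) => x; rewrite (le_trans (ler_normD _ _))// lerD.
Qed.

Lemma bounded_measurable_indic (c : R) A : measurable A ->
  bounded_measurable (fun x => c * \1_A x).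
Proof.
move=> mA; split.
  by apply: measurable_funM => //; exact: measurable_indic.
exists `|c| => x; rewrite normrM ler_piMr// indicE.
by case: (x \in A); rewrite ?normr1 ?normr0.
Qed.

Lemma Rintegral_indic P (c : R) A : measurable A ->
  \int[P]_x (c * \1_A x) = c * fine (P A).
Proof.
move=> mA; rewrite RintegralZl//; last first.
  have := bounded_measurable_integrable P _ (bounded_measurable_indic 1 A mA).
  by under eq_fun do rewrite mul1r.
by rewrite /Rintegral integral_indic// setIT.
Qed.

(** The pointwise bound is integrated, [P] having mass one. In the applications [A] is the
    exceptional set on which the approximation is poor. *)
Lemma Rintegral_dist_le P f g A (e L : R) : measurable A -> 0 <= L ->
  bounded_measurable f -> bounded_measurable g ->
  (forall x, `|f x - g x| <= e + L * \1_A x) ->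
  `|\int[P]_x f x - \int[P]_x g x| <= e + L * fine (P A).
Proof.
move=> mA L0 bf bg fg.
have If := bounded_measurable_integrable P _ bf.
have Ig := bounded_measurable_integrable P _ bg.
rewrite -RintegralB//.
have IB : P.-integrable setT (EFin \o (fun x => f x - g x)).
  exact: (integrableB measurableT If Ig).
apply: le_trans (le_normr_Rintegral _ IB) _ => //.
have be := bounded_measurable_indic e setT measurableT.
have bL := bounded_measurable_indic L A mA.
have -> : e + L * fine (P A) = \int[P]_x (e * \1_setT x + L * \1_A x).
  rewrite RintegralD//; try exact: bounded_measurable_integrable.
  by rewrite !Rintegral_indic// probability_setT mulr1.
apply: le_Rintegral => //.
- exact: integrable_norm IB.
- by apply: bounded_measurable_integrable; exact: bounded_measurableD.
- by move=> x _; rewrite indicT mulr1.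
Qed.

End bounded_measurable.

Section weak_convergence.
Context {R : realType} {n : nat}.
Local Notation borel := (borelRn R n).

Lemma continuous_bounded_measurable (f : 'rV[R]_n -> R) :
  continuous f -> bounded_fun f -> bounded_measurable (f : borel -> R).
Proof.
move=> cf [M [_ fM]]; split; first exact: continuous_borel.
by exists (M + 1) => x; apply: fM => //; rewrite ltrDl.
Qed.

Context {I : Type} (F : set_system I) {FF : Filter F}.
Variables (P : I -> borel_prob R n) (nu : borel_prob R n).

Let cvg_integral (g : borel -> R) : Prop := bounded_measurable g /\
  \int[P i]_x g x @[i --> F] --> \int[nu]_x g x.

Let cvg_integralD (g h : borel -> R) : cvg_integral g -> cvg_integral h ->
  cvg_integral (fun x => g x + h x).
Proof.
move=> [bg cg] [bh ch]; split; first exact: bounded_measurableD.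
rewrite RintegralD//; try exact: bounded_measurable_integrable.
rewrite (_ : (fun _ => _) = (fun i => \int[P i]_x g x + \int[P i]_x h x)).
  exact: cvgD.
apply/funext => i; rewrite RintegralD//; exact: bounded_measurable_integrable.
Qed.

Variable G : set (set borel).
Hypotheses (Gmeas : G `<=` measurable).
Hypotheses (GC : setC_closed G) (GI : setI_closed G).
Hypothesis Gbox : forall a b, G (box a b).
Hypothesis Gcvg : forall A, G A -> fine (P i A) @[i --> F] --> fine (nu A).

Let cvg_integral_indic (c : R) A : G A -> cvg_integral (fun x => c * \1_A x).
Proof.
move=> GA; have mA := Gmeas _ GA.
split; first exact: bounded_measurable_indic.
rewrite Rintegral_indic//.
rewrite (_ : (fun _ => _) = (fun i => c * fine (P i A))).
  by apply: cvgM; [exact: cvg_cst|exact: Gcvg].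
by apply/funext => i; rewrite Rintegral_indic.
Qed.

(** Induction on the list of centers: each new box overrides [g] inside itself. The old step
    function is multiplied by the indicator of the complement of that box, which is why convergence
    is carried along for [g] times the indicator of any set in [G]. *)
Let step_approx (f : 'rV[R]_n -> R) (r : 'rV[R]_n -> R) (e : R)
    (s : seq 'rV[R]_n) : 0 <= e ->
  (forall c x, box (c - const_mx (r c)) (c + const_mx (r c)) x ->
     `|f x - f c| <= e) ->
  exists g : borel -> R,
    (forall A, G A -> cvg_integral (fun x => g x * \1_A x)) /\
    forall x, `|f x - g x| <= e \/
      g x = 0 /\ forall c, c \in s ->
        ~ box (c - const_mx (r c)) (c + const_mx (r c)) x.
Proof.
move=> e0 fr; elim: s => [|c s [g [cg fg]]].
  exists (fun=> 0); split=> [A GA|x]; last by right.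
  by have := cvg_integral_indic 0 A GA.
pose B : set borel := box (c - const_mx (r c)) (c + const_mx (r c)).
exists (fun x => f c * \1_B x + g x * \1_(~` B) x); split=> [A GA|x].
  rewrite (_ : (fun _ => _) = fun x =>
      f c * \1_(B `&` A) x + g x * \1_(~` B `&` A) x).
    apply: cvg_integralD.
      by apply: cvg_integral_indic; apply: GI => //; exact: Gbox.
    by apply: cg; apply: GI => //; apply: GC; exact: Gbox.
  by apply/funext => x; rewrite !indicI/= mulrDl !mulrA.
have [Bx|nBx] := pselect (B x).
  left; rewrite !indicE mem_set// memNset; last by move/(_ Bx).
  by rewrite mulr1 mulr0 addr0; exact: fr.
rewrite !indicE memNset// mem_set// mulr0 mulr1 add0r.
have [|[gx sx]] := fg x; [by left|right; split=> // b].
by rewrite inE => /orP[/eqP ->//|/sx].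
Qed.

Hypothesis tight : forall e : R, 0 < e -> exists M : R,
  fine (nu (~` cube M)) < e /\ forall i, fine (P i (~` cube M)) < e.

(** [f] is replaced by a step function [g] on finitely many small boxes covering a large cube. Under
    [nu] and under [P i] alike this costs [e / 5] for the oscillation and [e / 5] for the mass
    outside the cube; the last fifth pays for the convergence of the integrals of [g]. *)
Lemma cvg_Rintegral (f : 'rV[R]_n -> R) : continuous f -> bounded_fun f ->
  \int[P i]_x f x @[i --> F] --> \int[nu]_x f x.
Proof.
move=> cf bf; have bmf := continuous_bounded_measurable f cf bf.
(* Adding 1 makes [L] positive, so that the tail can be required to be below [e / 5 / L]. *)
have [_ [L0 fL0]] := bmf; pose L := `|L0| + 1.
have L_gt0 : 0 < L by rewrite ltr_wpDl.
have fL x : `|f x| <= L.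
  by rewrite (le_trans (fL0 x))// (le_trans (ler_norm _))// lerDl.
apply/cvgrPdist_lt => e e0.
have e50 : 0 < e / 5 by rewrite divr_gt0.
have [|M [nuM PM]] := tight (e / 5 / L); first by rewrite divr_gt0.
have /choice[r rP] (c : 'rV[R]_n) : exists r : R, 0 < r /\
    forall x, box (c - const_mx r) (c + const_mx r) x -> `|f x - f c| <= e / 5.
  have /cvgrPdist_le/(_ _ e50) := cf c.
  move=> /nbhs_ballP[d /= d0 dfc]; exists (d / 2); split; first exact: divr_gt0.
  move=> x cx; rewrite distrC; apply: dfc; split=> // i j.
  rewrite ord1 -ball_normE/= distrC (@le_lt_trans _ _ (d / 2))//.
    by have := cx j; rewrite !mxE ler_distl.
  by rewrite ltr_pdivrMr// ltr_pMr// ltr1n.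
have := @compact_box R n (const_mx (- M)) (const_mx M).
pose B c := box (c - const_mx (r c)) (c + const_mx (r c)).
rewrite compact_cover => /(_ _ setT (fun c => (B c)^°))[c _||D _ MD].
- exact: open_interior.
- by move=> x _; exists x => //; apply: nbhs_box; have [] := rP x.
have [//||g [cg fg]] := step_approx f r (e / 5) (enum_fset D).
- exact: ltW.
- by move=> c x; have [_] := rP c; apply.
(* The empty set is a box met with its own complement, so the closure properties of [G] yield the
   whole space. *)
have GT : G setT.
  rewrite -setC0 -(setICr (box 0 0)).
  by apply: GC; apply: GI; [|apply: GC]; exact: Gbox.
have [] := cg _ GT.
rewrite (_ : (fun _ => _) = g); last by apply/funext => x; rewrite indicT mulr1.
move=> bg /cvgrPdist_lt/(_ _ e50) nearg.
have mM : measurable (~` cube M : set borel).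
  by apply: measurableC; exact: box_borel.
(* Where no box catches [x], [g] vanishes and the error is at most [L]; such an [x] lies outside the
   cube, which the boxes cover. *)
have fgM x : `|f x - g x| <= e / 5 + L * \1_(~` cube M) x.
  have [fgx|[gx Dx]] := fg x.
    by rewrite (le_trans fgx)// lerDl mulr_ge0// ltW.
  rewrite indicE mem_set.
    by rewrite gx subr0 mulr1 (le_trans (fL x))// lerDr ltW.
  by move=> /MD[c /= cD /interior_subset]; exact: Dx.
have close (Q : borel_prob R n) : fine (Q (~` cube M)) < e / 5 / L ->
    `|\int[Q]_x f x - \int[Q]_x g x| < e / 5 + e / 5.
  have := Rintegral_dist_le Q _ _ _ _ _ mM (ltW L_gt0) bmf bg fgM.
  move=> /le_lt_trans + QM; apply.
  by rewrite ltrD2l mulrC -ltr_pdivlMr.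
near=> i.
have h : `|\int[nu]_x g x - \int[P i]_x g x| < e / 5 by near: i.
have h1 := close nu nuM; have h2 := close (P i) (PM i).
move: h h1 h2; rewrite !ltr_norml; lra.
Unshelve. all: by end_near. Qed.

End weak_convergence.

(** Closed bounded intervals form a pi-system, exhaust the line and generate its Borel sets, a
    closed ray being a countable union of them. Their coordinate preimages are known to be regular,
    which is what identifies the marginals of the limit. *)
Lemma measure_itv_unique (R : realType)
    (m1 m2 : {measure set (measurableTypeR R) -> \bar R}) : (m1 setT < +oo)%E ->
  (forall a b : R, m1 `[a, b]%classic = m2 `[a, b]%classic) ->
  forall A, measurable A -> m1 A = m2 A.
Proof.
move=> m1oo m12 A mA.
pose G : set (set (measurableTypeR R)) :=
  [set B | exists a b : R, B = `[a, b]%classic].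
have GA : <<s G >> A.
  move: mA; rewrite RGenCInfty.measurableE; apply: smallest_sub.
    exact: smallest_sigma_algebra.
  move=> _ [x ->].
  have -> : `[x, +oo[%classic = \bigcup_(k : nat) `[x, x + k%:R]%classic.
    apply/seteqP; split=> [y|y [k _]]; rewrite /= !in_itv/= ?andbT; last first.
      by move=> /andP[].
    move=> xy; exists (Num.truncn (y - x)).+1 => //=.
    by rewrite in_itv/= xy/= -lerBlDl ltW// Num.Theory.truncnS_gt.
  apply: (@sigma_algebra_bigcup _ setT) => k.
  by apply: sub_sigma_algebra; exists x, (x + k%:R).
apply: (@g_sigma_algebra_measure_unique _ _ _ G _
  (fun k => `[- k%:R, k%:R]%classic)) GA => //.
- by move=> _ [a [b ->]]; exact: measurable_itv.
- by move=> k; exists (- k%:R), k%:R.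
- apply/seteqP; split=> // x _; exists (Num.truncn `|x|).+1 => //=.
  by rewrite in_itv/= -ler_norml ltW// Num.Theory.truncnS_gt.
- move=> _ _ [a [b ->]] [c [e ->]]; exists (Num.max a c), (Num.min b e).
  apply/seteqP; split=> x; rewrite /setI/= !in_itv/= ge_max le_min.
    by move=> [/andP[-> ->] /andP[-> ->]].
  by move=> /andP[/andP[-> ->] /andP[-> ->]].
- by move=> _ [a [b ->]]; exact: m12.
- move=> k; apply: le_lt_trans m1oo.
  by rewrite le_measure ?inE//; exact: measurable_itv.
Qed.

Lemma ultralimit_weak (R : realType) (n : nat)
    (mu : probability (measurableTypeR R) R) (I : Type) (F : set_system I)
    (P : I -> borel_prob R n) : UltraFilter F ->
  (forall i, has_marginals mu (P i)) -> exists nu : borel_prob R n,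
    has_marginals mu nu /\
    forall f : 'rV[R]_n -> R, continuous f -> bounded_fun f ->
      \int[P i]_x f x @[i --> F] --> \int[nu]_x f x.
Proof.
move=> FU P_mu; have [nu nuP] := ultralimit_measure mu F P P_mu.
have nu_mu : has_marginals mu nu.
  move=> i.
  have [p pE] := pushforward_measureE _ _ _ _ _ nu _ (@measurable_coord R n i).
  move=> A mA; rewrite -pE.
  apply: measure_itv_unique mA => [|a b].
    rewrite pE /pushforward preimage_setT.
    by rewrite (le_lt_trans (@probability_le1 _ _ _ nu _ measurableT)) ?ltry.
  have mI : measurable (`[a, b]%classic : set (measurableTypeR R)).
    exact: measurable_itv.
  rewrite pE /pushforward -[RHS]fineK; last exact: fin_num_measure.
  rewrite -[LHS]fineK; last first.
    apply: fin_num_measure.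
    by rewrite -[X in measurable X]setTI; exact: measurable_coord.
  congr EFin.
  (* The slab is regular, so its [nu]-mass is the limit of masses that are all equal to the
     [mu]-mass of the interval. *)
  have nu_ab := nuP _ (@ultraregular_coord R n mu I F FU P P_mu i a b).
  apply: (@norm_cvg_unique R R (fine (P j _) @[j --> F])) nu_ab _.
  rewrite (_ : (fun _ => _) = cst (fine (mu `[a, b]%classic))).
    exact: cvg_cst.
  by apply/funext => j; rewrite -(P_mu j i _ mI).
exists nu; split=> // f.
apply: (cvg_Rintegral F P nu (ultraregular F P)) => //.
- by move=> A [].
- exact: (ultraregularC mu).
- exact: (ultraregularI mu).
- exact: (ultraregular_box mu).
(* As [nu] itself has marginals [mu], one cube is good for the limit and for all [P i] at once. *)
- move=> e e0; have [M M0 Me] := @cube_tight _ n mu _ e0; exists M.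
  have mM : measurable (~` cube M : set (borelRn R n)).
    by apply: measurableC; exact: box_borel.
  by split=> [|i]; rewrite -lte_fin fineK ?fin_num_measure//; exact: Me.
Qed.

(** * Coordinate sums *)

Section constant_almost_everywhere.
Context {R : realType} {d} {T : measurableType d} (P : probability T R).
Implicit Types f : T -> R.

(** [f] is compared with the constant [c]: they differ at most on the complement of [E], a null set,
    and there by a bounded amount. *)
Lemma Rintegral_constant f (E : set T) (c : R) : bounded_measurable f ->
  measurable E -> P E = 1%E -> (forall x, E x -> f x = c) ->
  \int[P]_x f x = c.
Proof.
move=> bf mE PE fE; have [_ [L fL]] := bf.
have bc : bounded_measurable (fun _ : T => c).
  by split; [exact: measurable_cst|exists `|c|].
have Pc : \int[P]_x c = c.
  by rewrite /Rintegral integral_cst//= (@probability_setT _ _ _ P) mule1.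
have PCE : P (~` E) = 0%E by rewrite probability_setC// PE subee.
have := Rintegral_dist_le P f _ (~` E) 0 (`|L| + `|c|) (measurableC mE) _ bf bc.
rewrite PCE mulr0 addr0 normr_le0 subr_eq0 Pc => h.
apply/eqP/h => [|x]; first exact: addr_ge0.
rewrite add0r indicE; have [Ex|nEx] := pselect (E x).
  by rewrite fE// subrr normr0 mulr_ge0// addr_ge0.
rewrite mem_set// mulr1 (le_trans (ler_normB _ _))// lerD2r.
by rewrite (le_trans (fL x))// ler_norm.
Qed.

Lemma Rintegral_eq0 f : bounded_measurable f -> (forall x, 0 <= f x) ->
  \int[P]_x f x = 0 -> P [set x | f x = 0] = 1%E.
Proof.
move=> bf f0 If0; have [mf _] := bf.
have mf0 : measurable [set x | f x = 0].
  by rewrite -[X in measurable X]setTI; exact: (mf measurableT [set 0]).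
have mEf : measurable_fun setT (EFin \o f) by exact/measurable_EFinP.
have /(ae_eq_integral_abs P measurableT mEf)nf0 :
    (\int[P]_x `|(EFin \o f) x| = 0)%E.
  have := EFin_normr_Rintegral measurableT
    (bounded_measurable_integrable P f bf).
  rewrite If0 normr0 => /esym/eqP; rewrite abse_eq0 => /eqP <-.
  by apply: eq_integral => x _; rewrite gee0_abs ?lee_fin.
have {}nf0 : P (~` [set x | f x = 0]) = 0%E.
  apply: measure_negligible; first exact: measurableC.
  apply: negligibleS nf0 => x /=.
  by apply: contra_not => /(_ I)[].
by rewrite -[X in P X]setCK probability_setC ?nf0 ?sube0//; exact: measurableC.
Qed.

End constant_almost_everywhere.

Section coordinate_sum.
Context {R : realType} {n : nat}.
Local Notation borel := (borelRn R n).

Definition row_sum (x : 'rV[R]_n) : R := \sum_(i < n) x ord0 i.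

Lemma continuous_row_sum : continuous row_sum.
Proof.
apply: continuous_big => [|i _]; first exact: add_continuous.
exact: coord_continuous.
Qed.

Lemma measurable_row_sum_eq (C : R) :
  measurable ([set x | row_sum x = C] : set borel).
Proof.
apply: closed_borel; apply: (@preimage_closed _ _ row_sum [set C]) => [x _|].
  exact: continuous_row_sum.
exact: closed_eq.
Qed.

Definition truncated_sum (B : R) (x : 'rV[R]_n) : R :=
  Num.max (- B) (Num.min B (row_sum x)).

Lemma continuous_truncated_sum (B : R) : continuous (truncated_sum B).
Proof.
move=> x.
apply: (@continuous_max _ _ (cst (- B)) (fun x => Num.min B (row_sum x))).
  exact: cst_continuous.
apply: (@continuous_min _ _ (cst B) row_sum); first exact: cst_continuous.
exact: continuous_row_sum.
Qed.

Lemma bounded_truncated_sum (B : R) : bounded_fun (truncated_sum B).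
Proof.
exists `|B|; split; first exact: num_real.
move=> M BM x _ /=; rewrite (le_trans _ (ltW BM))// ler_norml /truncated_sum.
by rewrite le_max ge_max ge_min lerN2 ler_norm/= -normrN ler_norm.
Qed.

Lemma truncated_sumE (B C : R) x : `|C| <= B -> row_sum x = C ->
  truncated_sum B x = C.
Proof.
rewrite ler_norml => /andP[BC CB] xC.
by rewrite /truncated_sum xC (min_idPr CB) (max_idPr BC).
Qed.

(** A bounded continuous test function whose zero set is the hyperplane of sum [C]; a vanishing
    integral therefore detects concentration on it. *)
Definition sum_gap (C : R) (x : 'rV[R]_n) : R := Num.min 1 `|row_sum x - C|.

Lemma continuous_sum_gap (C : R) : continuous (sum_gap C).
Proof.
move=> x; apply: (@continuous_min _ _ (cst 1) (fun x => `|row_sum x - C|)).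
  exact: cst_continuous.
apply: (@continuous_comp _ _ _ (fun x => row_sum x - C)).
  apply: (@continuousB _ R _ row_sum (cst C)); last exact: cst_continuous.
  exact: continuous_row_sum.
exact: norm_continuous.
Qed.

Lemma sum_gap_ge0 (C : R) x : 0 <= sum_gap C x.
Proof. by rewrite le_min ler01 normr_ge0. Qed.

Lemma bounded_sum_gap (C : R) : bounded_fun (sum_gap C).
Proof.
exists 1; split=> // M M1 x _ /=; rewrite ger0_norm ?sum_gap_ge0//.
by rewrite ge_min ltW.
Qed.

Lemma sum_gap_eq0 (C : R) : [set x | sum_gap C x = 0] = [set x | row_sum x = C].
Proof.
apply/seteqP; split=> x /=; last first.
  by move=> xC; rewrite /sum_gap xC subrr normr0 (min_idPr _).
rewrite /sum_gap; have [_ /eqP|_ /eqP] := leP 1 `|row_sum x - C|.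
  by rewrite oner_eq0.
by rewrite normr_eq0 subr_eq0 => /eqP.
Qed.

Lemma Rintegral_truncated_sum (P : borel_prob R n) (B C : R) :
  `|C| <= B -> sum_is P C -> \int[P]_x truncated_sum B x = C.
Proof.
move=> CB PC.
apply: (Rintegral_constant P _ _ _ _ (measurable_row_sum_eq C) PC) => [|x].
  apply: continuous_bounded_measurable; first exact: continuous_truncated_sum.
  exact: bounded_truncated_sum.
exact: truncated_sumE.
Qed.

Lemma Rintegral_sum_gap (P : borel_prob R n) (C D : R) :
  sum_is P D -> \int[P]_x sum_gap C x = Num.min 1 `|D - C|.
Proof.
move=> PD.
apply: (Rintegral_constant P _ _ _ _ (measurable_row_sum_eq D) PD) => [|x].
  apply: continuous_bounded_measurable; first exact: continuous_sum_gap.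
  exact: bounded_sum_gap.
by move=> xD; rewrite /sum_gap xD.
Qed.

Lemma sum_is_gap (P : borel_prob R n) (C : R) :
  \int[P]_x sum_gap C x = 0 -> sum_is P C.
Proof.
move=> PC; rewrite /sum_is -[X in P X](sum_gap_eq0 C).
apply: Rintegral_eq0 => //; last exact: sum_gap_ge0.
apply: continuous_bounded_measurable; first exact: continuous_sum_gap.
exact: bounded_sum_gap.
Qed.

(* Some mass of [P] lies in a cube depending on [mu] only, so the constant value
   of the coordinate sum is attained inside that cube. *)
Lemma sum_is_bounded (mu : probability (measurableTypeR R) R) :
  exists B : R, forall (P : borel_prob R n) C,
    has_marginals mu P -> sum_is P C -> `|C| <= B.
Proof.
have [M M0 Me] := @cube_tight _ n mu 1 ltr01.
exists (n%:R * M) => P C /Me PM PC.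
have [x [xM xC]] : exists x, cube M x /\ row_sum x = C.
  apply: contrapT => /forallNP nx; move: PM; apply/negP; rewrite -leNgt.
  rewrite -PC le_measure ?inE//.
  - exact: measurable_row_sum_eq.
  - by apply: measurableC; exact: box_borel.
  - by move=> x xC xM; apply: (nx x).
rewrite -xC (le_trans (ler_norm_sum _ _ _))// -[n in n%:R]card_ord mulr_natl.
by rewrite -sumr_const ler_sum// => i _; exact: ((cubeP M x).1 xM i).
Qed.

End coordinate_sum.

(** * Metrizability *)

Section countably_many_functions.
Context {R : realType} {T : topologicalType} (g : nat -> T -> R).
Hypotheses (T_compact : compact [set: T]) (g_cont : forall k, continuous (g k)).
Hypothesis g01 : forall k x, 0 <= g k x <= 1.
Hypothesis g_sep : forall x y, (forall k, g k x = g k y) -> x = y.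

Let gap x y k : R := `|g k x - g k y| / k.+1%:R.

(** A weighted sup metric of the Hilbert cube, pulled back along the map with components [g k]. *)
Let dist x y : R := sup (range (gap x y)).

Let gap_ge0 x y k : 0 <= gap x y k.
Proof. by rewrite divr_ge0. Qed.

Let gap_le1 x y k : gap x y k <= k.+1%:R^-1.
Proof.
rewrite ler_piMl ?invr_ge0// ler_norml.
have /andP[? ?] := g01 k x; have /andP[? ?] := g01 k y; apply/andP; split; lra.
Qed.

Let gap_le_dist x y k : gap x y k <= dist x y.
Proof.
apply: sup_upper_bound; last by exists k.
split; first by exists (gap x y 0%N), 0%N.
exists 1 => _ [l _ <-]; rewrite (le_trans (gap_le1 x y l))//.
by rewrite invf_le1 ?ltr0n// ler1n.
Qed.

Let dist_le x y e : (forall k, gap x y k <= e) -> dist x y <= e.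
Proof.
move=> xye; apply: ge_sup; first by exists (gap x y 0%N), 0%N.
by move=> _ [k _ <-].
Qed.

Let dist_ge0 x y : 0 <= dist x y.
Proof. exact: le_trans (gap_ge0 x y 0%N) (gap_le_dist x y 0%N). Qed.

Let dist_sym x y : dist x y = dist y x.
Proof.
rewrite /dist (_ : gap x y = gap y x)//.
by apply/funext => k; rewrite /gap distrC.
Qed.

Let dist_eq0 x y : dist x y = 0 <-> x = y.
Proof.
split=> [xy0|->]; last first.
  apply/eqP; rewrite eq_le dist_ge0 andbT; apply: dist_le => k.
  by rewrite /gap subrr normr0 mul0r.
apply: g_sep => k; apply/eqP; rewrite -subr_eq0 -normr_le0.
have := gap_le_dist x y k; by rewrite xy0 /gap pmulr_lle0.
Qed.

Let dist_triangle x y z : dist x z <= dist x y + dist y z.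
Proof.
apply: dist_le => k.
apply: le_trans (lerD (gap_le_dist x y k) (gap_le_dist y z k)).
rewrite /gap -mulrDl ler_wpM2r ?invr_ge0//.
by rewrite -(subrKA (g k y)) ler_normD.
Qed.

Let ball_filter x :=
  filter_from [set e : R | 0 < e] (fun e => [set y | dist x y < e]).

Let ball_filter_proper x : ProperFilter (ball_filter x).
Proof.
apply: filter_from_proper; last first.
  by move=> e e0; exists x; rewrite /= (dist_eq0 x x).2.
apply: filter_from_filter; first by exists 1; exact: ltr01.
move=> e d e0 d0; exists (Num.min e d); first by rewrite /= lt_min e0.
by move=> y /=; rewrite lt_min => /andP[].
Qed.

(** From the index [N] on, the weights alone keep [gap] below [e / 2], so finitely many continuity
    conditions suffice. *)
Let nbhs_dist x e : 0 < e -> nbhs x [set y | dist x y < e].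
Proof.
move=> e0; have e20 : 0 < e / 2 by rewrite divr_gt0.
have [N _ Ne] : exists2 N : nat, True & N.+1%:R^-1 < e / 2.
  by have [N] := @ltr_add_invr R 0 (e / 2) e20; rewrite add0r; exists N.
have : \forall y \near x, forall k : 'I_N, `|g k x - g k y| <= e / 2.
  apply: filter_forall => k.
  by have /cvgrPdist_le/(_ _ e20) := g_cont k x.
apply: filterS => y xy; apply: (@le_lt_trans _ _ (e / 2)); last first.
  by rewrite ltr_pdivrMr// ltr_pMr// ltr1n.
apply: dist_le => k; have [kN|Nk] := ltnP k N.
  rewrite /gap ler_pdivrMr ?ltr0n// (le_trans (xy (Ordinal kN)))//.
  by rewrite ler_peMr ?ler1n// ltW.
rewrite (le_trans (gap_le1 x y k))// (le_trans _ (ltW Ne))//.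
by rewrite lef_pV2 ?posrE// ler_nat ltnS.
Qed.

(** Some finer filter converges to [y]; along it [g k] tends to both [g k y] and [g k x]. *)
Let cluster_eq (F : set_system T) x y : ProperFilter F ->
  (forall k, g k @ F --> g k x) -> cluster F y -> y = x.
Proof.
move=> FF Fx; rewrite cluster_cvgE => -[H HF [Hy FH]].
apply: g_sep => k.
apply: (@norm_cvg_unique R R (g k @ H)).
  by apply: cvg_trans (g_cont k y); exact: cvg_app.
by apply: cvg_trans (Fx k); exact: cvg_app.
Qed.

(** Balls are neighbourhoods by [nbhs_dist]. Conversely, the filter of balls around [x] has [x] as
    its only cluster point, so by compactness it converges to [x], which puts a ball inside every
    neighbourhood. *)
Lemma compact_metrizable : metrizable R T.
Proof.
exists dist; split=> // x; apply/seteqP; split=> [U xU|U [e /= e0 /filterS]].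
  have hT : hausdorff_space T.
    by move=> p q pq; apply/esym/(cluster_eq _ _ _ _ _ pq) => k; exact: g_cont.
  suff : ball_filter x --> x by apply.
  have BF := ball_filter_proper x.
  apply: (compact_cluster_set1 hT T_compact) => //; [exact: filterT..|].
  apply/seteqP; split=> [y|_ ->].
    apply: cluster_eq => k; apply/cvgrPdist_lt => e e0.
    exists (e / k.+1%:R); first by rewrite /= divr_gt0.
    move=> z /= xz; have := le_lt_trans (gap_le_dist x z k) xz.
    by rewrite /gap ltr_pM2r ?invr_gt0.
  move=> A B [e /= e0 eA] /nbhs_singleton Bx; exists x; split=> //.
  by apply: eA; rewrite /= (dist_eq0 x x).2.
by apply; exact: nbhs_dist.
Qed.

End countably_many_functions.

(** * Countably many test functions that determine a Borel probability *)

Section separation.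
Context {R : realType} {n : nat}.
Local Notation borel := (borelRn R n).
Implicit Types (q : 'rV[rat]_n * 'rV[rat]_n) (P Q : borel_prob R n).

(** The l1 distance from [x] to the box when the box is nonempty. *)
Definition rat_box_excess q (x : 'rV[R]_n) : R :=
  \sum_(i < n) (Num.max 0 (ratr (q.1 ord0 i) - x ord0 i) +
                Num.max 0 (x ord0 i - ratr (q.2 ord0 i))).

Definition rat_box_bump q (x : 'rV[R]_n) : R :=
  Num.max 0 (1 - rat_box_excess q x).

Lemma continuous_rat_box_bump q : continuous (rat_box_bump q).
Proof.
have max0 (f : 'rV[R]_n -> R) : continuous f ->
    continuous (fun x => Num.max 0 (f x)).
  move=> cf x.
  by apply: (@continuous_max _ _ (cst 0) f); [exact: cst_continuous|exact: cf].
apply: (max0) => x; apply: (@continuousB _ R _ (cst 1) (rat_box_excess q)).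
  exact: cst_continuous.
apply: continuous_big x => [|i _]; first exact: add_continuous.
move=> x; apply: (@continuousD _ R _
  (fun x : 'rV[R]_n => Num.max 0 (ratr (q.1 ord0 i) - x ord0 i))
  (fun x : 'rV[R]_n => Num.max 0 (x ord0 i - ratr (q.2 ord0 i)))).
  apply: (max0) => {}x.
  apply: (@continuousB _ R _ (cst _) (fun x : 'rV[R]_n => x ord0 i)).
    exact: cst_continuous.
  exact: coord_continuous.
apply: (max0) => {}x.
apply: (@continuousB _ R _ (fun x : 'rV[R]_n => x ord0 i) (cst _)).
  exact: coord_continuous.
exact: cst_continuous.
Qed.

Lemma rat_box_excess_ge0 q x : 0 <= rat_box_excess q x.
Proof. by apply: sumr_ge0 => i _; rewrite addr_ge0// le_max lexx. Qed.

Lemma rat_box_bump01 q x : 0 <= rat_box_bump q x <= 1.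
Proof.
by rewrite /rat_box_bump le_max lexx ge_max ler01 gerBl rat_box_excess_ge0.
Qed.

Lemma rat_box_bump_eq1 q x : rat_box q x <-> rat_box_bump q x = 1.
Proof.
split=> [xq|].
  rewrite /rat_box_bump /rat_box_excess big1 ?subr0 ?(max_idPr ler01)// => i _.
  have := xq i; rewrite !mxE => /andP[qx xq'].
  by rewrite !max_l ?addr0// subr_le0.
rewrite /rat_box_bump.
case: leP => [_ /eqP|_ /esym/eqP]; last by rewrite oner_eq0.
rewrite -subr_eq0 addrAC subrr add0r oppr_eq0 psumr_eq0; last first.
  by move=> i _; rewrite addr_ge0// le_max lexx.
move=> /allP xq i; have := xq i (mem_index_enum i).
rewrite /= paddr_eq0 ?le_max ?lexx// !mxE => /andP[/eqP l /eqP r].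
apply/andP; split; rewrite -subr_le0.
  by rewrite -l le_max lexx orbT.
by rewrite -r le_max lexx orbT.
Qed.

(** The bump is 1 exactly on the box and below 1 elsewhere, so its powers tend pointwise to the
    indicator of the box, dominated by the constant 1. *)
Lemma Rintegral_bump_pow P q :
  \int[P]_x (rat_box_bump q x ^+ j) @[j --> \oo] --> fine (P (rat_box q)).
Proof.
have bX j : bounded_measurable ((fun x => rat_box_bump q x ^+ j) : borel -> R).
  split.
    apply: measurable_funX; apply: continuous_borel.
    exact: continuous_rat_box_bump.
  exists 1 => x; have /andP[b0 b1] := rat_box_bump01 q x.
  by rewrite ger0_norm ?exprn_ge0// exprn_ile1.
have mq : measurable (rat_box q : set borel) by exact: box_borel.
have [] := @dominated_convergence _ borel R P setT measurableT
  (fun j x => (rat_box_bump q x ^+ j)%:E) (fun x => (\1_(rat_box q) x)%:E)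
  (cst 1%E).
- by move=> j; apply/measurable_EFinP; case: (bX j).
- by apply/measurable_EFinP; exact: measurable_indic.
- apply: aeW => x _; apply: cvg_EFin; first by apply: nearW.
  have /andP[b0 b1] := rat_box_bump01 q x.
  rewrite indicE; have [xq|nxq] := pselect (rat_box q x).
    rewrite mem_set// (rat_box_bump_eq1 q x).1//.
    by under eq_fun do rewrite expr1n; exact: cvg_cst.
  rewrite memNset//; apply: cvg_expr; rewrite ger0_norm// lt_neqAle b1 andbT.
  by apply: contra_notN nxq => /eqP/rat_box_bump_eq1.
- by apply/integrableP; split; [exact: measurable_cst|];
    rewrite integral_cst//= normr1 mul1e (@probability_setT _ _ _ P) ltry.
- apply: aeW => x j _ /=; have /andP[b0 b1] := rat_box_bump01 q x.
  by rewrite lee_fin ger0_norm ?exprn_ge0// exprn_ile1.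
move=> _ _; rewrite integral_indic// setIT => PE.
apply: (@fine_cvg _ _ _ _ (fun j => \int[P]_x (rat_box_bump q x ^+ j)%:E)%E).
by rewrite fineK ?fin_num_measure.
Qed.

Lemma borel_prob_eq P Q : (forall A : set borel, measurable A -> P A = Q A) ->
  P = Q.
Proof.
move=> PQ; apply: val_inj => /=; apply: eq_probability => A.
have [mA|nmA] := pselect (measurable A); first exact: PQ.
by rewrite (set_mem (valP P))// (set_mem (valP Q)).
Qed.

(** The limits in [j] recover the masses of the rational boxes, a generating pi-system that exhausts
    the space. *)
Lemma borel_prob_bump_separated P Q : (forall q j,
    \int[P]_x (rat_box_bump q x ^+ j) = \int[Q]_x (rat_box_bump q x ^+ j)) ->
  P = Q.
Proof.
move=> PQ; apply: borel_prob_eq => A mA.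
have PQbox q : P (rat_box q) = Q (rat_box q).
  have mq : measurable (rat_box q : set borel) by exact: box_borel.
  rewrite -[LHS]fineK ?fin_num_measure// -[RHS]fineK ?fin_num_measure//.
  congr EFin; have := Rintegral_bump_pow P q.
  rewrite (_ : (fun _ => _) = (fun j => \int[Q]_x (rat_box_bump q x ^+ j))).
    move=> Pq.
    exact: (@norm_cvg_unique R R _ _ _ _ Pq (Rintegral_bump_pow Q q)).
  by apply/funext => j; exact: PQ.
pose G : set (set borel) := [set B | exists q, B = rat_box q].
apply: (@g_sigma_algebra_measure_unique _ _ _ G _
  (fun k => rat_box (const_mx (- k%:R), const_mx k%:R))).
- by move=> _ [q ->]; exact: box_borel.
- by move=> k; eexists.
- apply/seteqP; split=> // x _.
  have [M xM] : exists M : nat, forall i, `|x ord0 i| <= M%:R.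
    exists (\sum_i (Num.truncn `|x ord0 i|).+1)%N => i.
    rewrite (le_trans (ltW (Num.Theory.truncnS_gt _)))// ler_nat.
    by rewrite (bigD1 i)//= leq_addr.
  exists M => // i; have := xM i; rewrite !mxE ler_norml.
  by rewrite rmorphN/= ratr_nat.
- move=> _ _ [q1 ->] [q2 ->]; have [q <-] := @rat_boxI R n q1 q2.
  by exists q.
- by move=> _ [q ->]; exact: PQbox.
- move=> k; rewrite (le_lt_trans (probability_le1 _ _)) ?ltry//.
  exact: box_borel.
- apply: rat_box_generate mA => q; apply: sub_sigma_algebra.
  by exists q.
Qed.

End separation.

(** * The space of couplings with constant sum *)

Section Lambda_topology.
Context {R : realType} {n : nat} (mu : probability (measurableTypeR R) R).
Local Notation L := (Lambda n mu).

Lemma Lambda_cvgP (F : set_system L) (P : L) : Filter F ->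
  F --> P <-> forall f : 'rV[R]_n -> R, continuous f -> bounded_fun f ->
    (fun Q : L => \int[measure_of (val Q)]_x f x) @ F -->
      \int[measure_of (val P)]_x f x.
Proof.
move=> FF; split=> [FP f cf bf|wFP].
  have vFP : (val : L -> borel_prob R n) @ F --> val P.
    apply: cvg_trans (cvg_app _ FP) _.
    exact: (@initial_continuous _ _ set_val).
  exact: ((weak_cvgP _ _).1 vFP f cf bf).
have vFP : (val : L -> borel_prob R n) @ F --> val P.
  by apply/weak_cvgP => f cf bf; exact: wFP.
move=> A [_ [[B oB <-] BP BA]]; apply: filterS BA _.
by apply: vFP; exact: open_nbhs_nbhs.
Qed.

Lemma continuous_expectation (f : 'rV[R]_n -> R) :
  continuous f -> bounded_fun f ->
  continuous (fun P : L => \int[measure_of (val P)]_x f x).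
Proof.
move=> cf bf P; have [+ _] := Lambda_cvgP (nbhs P) P _.
by move=> /(_ (fun A => id)); exact.
Qed.

Lemma Lambda_marginals (P : L) : has_marginals mu (val P).
Proof. by have [] := set_mem (valP P). Qed.

Lemma Lambda_sum : exists B : R, forall P : L, exists2 C : R,
  sum_is (val P) C & `|C| <= B.
Proof.
have [B BP] := @sum_is_bounded R n mu.
exists B => P; have [_ [C PC]] := set_mem (valP P).
by exists C => //; apply: BP PC; exact: Lambda_marginals.
Qed.

(** Every ultrafilter has a weak limit [nu] with marginals [mu]. The constants [C P] are integrals
    of one truncated sum, hence converge to some [c], and the integrals of [sum_gap c] then force
    [nu] onto the hyperplane of sum [c]. *)
Lemma Lambda_compact : compact [set: L].
Proof.
rewrite compact_ultra => F FU _.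
have [nu [nu_mu nu_cvg]] := ultralimit_weak _ _ mu _ F
  (fun P : L => val P) FU Lambda_marginals.
have [B LB] := Lambda_sum.
have /choice[C CP] (P : L) : exists C, sum_is (val P) C /\ `|C| <= B.
  by have [C] := LB P; exists C.
pose c := \int[nu]_x truncated_sum B x.
have Cc : C @ F --> c.
  rewrite (_ : C = fun P : L => \int[measure_of (val P)]_x truncated_sum B x).
    apply: nu_cvg; first exact: continuous_truncated_sum.
    exact: bounded_truncated_sum.
  apply/funext => P; have [PC CB] := CP P.
  by rewrite (Rintegral_truncated_sum _ B (C P)).
have nuc : sum_is nu c.
  apply: sum_is_gap.
  have gap_nu := nu_cvg _ (continuous_sum_gap c) (bounded_sum_gap c).
  (* The same integrals tend to 0, because under [P] the integral of [sum_gap c] is the minimum of 1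
     and the distance from [C P] to [c]. *)
  apply: (@norm_cvg_unique R R _ _ _ _ gap_nu).
  apply/cvgrPdist_lt => e e0; have /cvgrPdist_lt/(_ _ e0) := Cc.
  apply: filterS => P; have [PC _] := CP P.
  rewrite (Rintegral_sum_gap _ c (C P))// sub0r normrN distrC.
  move=> /(le_lt_trans _); apply.
  by rewrite ger0_norm ?le_min ?ler01//= ge_min lexx orbT.
have Lnu : L nu by split=> //; exists c.
by exists (exist _ nu (mem_set Lnu) : L); split=> //; apply/Lambda_cvgP.
Qed.

(** As [B] bounds all the constant sums, a single bounded continuous function computes every
    center. *)
Lemma phiE : exists B : R, forall P : L,
  phi P = (\int[measure_of (val P)]_x truncated_sum B x) / n%:R.
Proof.
have [B LB] := Lambda_sum; exists B => P; have [C PC CB] := LB P.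
by rewrite (Rintegral_truncated_sum _ B C)//; exact: ncenterE.
Qed.

Lemma continuous_phi : continuous (phi : L -> R).
Proof.
have [B phiB] := phiE.
rewrite (_ : phi = fun P : L =>
    (\int[measure_of (val P)]_x truncated_sum B x) / n%:R); last exact/funext.
have cT :
    continuous (fun P : L => \int[measure_of (val P)]_x truncated_sum B x).
  apply: (continuous_expectation (truncated_sum B)).
    exact: continuous_truncated_sum.
  exact: bounded_truncated_sum.
by move=> P; exact: (cvgM (cT P) (cvg_cst _)).
Qed.

Lemma Lambda_metrizable : metrizable R L.
Proof.
(* Enumerates the pairs of a rational box and an exponent; an index coding no pair gets the zero
   function. *)
pose t (k : nat) (x : 'rV[R]_n) : R :=
  if @choice.unpickle ('rV[rat]_n * 'rV[rat]_n * nat)%type k is Some (q, j)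
  then rat_box_bump q x ^+ j else 0.
have ct k : continuous (t k).
  rewrite /t; case: (choice.unpickle k) => [[q j]|]; last exact: cst_continuous.
  move=> x; apply: (@continuous_comp _ _ _ (rat_box_bump q) (fun y => y ^+ j)).
    exact: continuous_rat_box_bump.
  exact: exprn_continuous.
have t01 k x : 0 <= t k x <= 1.
  rewrite /t; case: (choice.unpickle k) => [[q j]|]; last by rewrite lexx ler01.
  have /andP[b0 b1] := rat_box_bump01 q x.
  by rewrite exprn_ge0//= exprn_ile1.
have bt k : bounded_fun (t k).
  exists 1; split=> // M M1 x _ /=; have /andP[t0 t1] := t01 k x.
  by rewrite ger0_norm// (le_trans t1)// ltW.
apply: (@compact_metrizable _ _
  (fun k (P : L) => \int[measure_of (val P)]_x t k x)).
- exact: Lambda_compact.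
- by move=> k; exact: continuous_expectation.
- move=> k P.
  have bmt := continuous_bounded_measurable (t k) (ct k) (bt k).
  apply/andP; split.
    by apply: Rintegral_ge0 => x _; have /andP[] := t01 k x.
  have bc1 : bounded_measurable (fun _ : borelRn R n => 1 : R).
    by split; [exact: measurable_cst|exists 1 => _; rewrite normr1].
  have <- : \int[measure_of (val P)]_x (1 : R) = 1.
    exact: (Rintegral_constant _ _ setT 1 bc1 measurableT (probability_setT _)).
  apply: le_Rintegral => [//|||x _]; try exact: bounded_measurable_integrable.
  by have /andP[] := t01 k x.
- move=> P Q PQ; apply: val_inj; apply: borel_prob_bump_separated => q j.
  by have := PQ (choice.pickle (q, j : nat)); rewrite /t choice.pickleK.
Qed.

End Lambda_topology.

(** * Smallest and largest center *)

Lemma compact_extrema (R : realType) (A : set R) : compact A -> A !=set0 ->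
  exists a b : R, [/\ a <= b, A a, A b &
    A `&` ([set` `]-oo, a[] `|` [set` `]b, +oo[]) = set0].
Proof.
move=> cA A0; have cid : {within A, continuous (id : R -> R)}.
  by apply: continuous_subspaceT => x; exact: cvg_id.
have [a /set_mem Aa amin] := compact_EVT_min A0 cA cid.
have [b /set_mem Ab bmax] := compact_EVT_max A0 cA cid.
exists a, b; split=> //; first by apply: amin; exact: mem_set.
rewrite -subset0 => x [Ax []];
  rewrite /= in_itv/= ?andbT; apply/negP; rewrite -leNgt.
  by apply: amin; exact: mem_set.
by apply: bmax; exact: mem_set.
Qed.

Theorem proposition3p1 (R : realType) (n : nat) (n_gt0 : (0 < n)%N)
    (mu : probability (measurableTypeR R) R)
    (mu_mix : completely_mixable n mu) :
  [/\ compact [set: Lambda n mu] /\ metrizable R (Lambda n mu),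
      continuous (phi : Lambda n mu -> R),
      compact (ncenters n mu)
    & exists a b : R,
        [/\ a <= b, ncenters n mu a, ncenters n mu b
          & ncenters n mu `&` ([set` `]-oo, a[] `|` [set` `]b, +oo[]) = set0]].
Proof.
have cphi := continuous_phi mu : continuous (phi : Lambda n mu -> R).
have cL : compact (ncenters n mu).
  apply: continuous_compact; last exact: Lambda_compact.
  exact: continuous_subspaceT.
split=> //; first by split; [exact: Lambda_compact|exact: Lambda_metrizable].
apply: compact_extrema => //; have [P LP] := mu_mix.
pose P' : Lambda n mu := exist _ P (mem_set LP).
by exists (phi P'), P'.
Qed.
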